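(* Let $G$ be an embedded graph. Then, as an identity in the indeterminate $\lambda$, $$P(G^*;\lambda)=\lambda^{c(G^{\times})}(-1)^{r(G^{\times})}R(G^{\times};1-\lambda,-\lambda,1/\lambda).$$
   Context: An embedded graph is a graph (loops and multiple edges allowed, not necessarily connected) cellularly embedded in a closed, possibly non-orientable, surface, i.e. each component of the complement (each face) is an open disc. Equivalently, it is a ribbon graph: a surface with boundary written as a union of vertex discs and edge discs (ribbons), each edge disc meeting the vertex discs in exactly two disjoint arcs. $c(G)$ is the number of connected components, $r(G)=|V(G)|-c(G)$, $n(G)=|E(G)|-r(G)$, and $f(G)$ is the number of boundary components of the ribbon graph (number of faces). For $A\subseteq E(G)$, $c(A),r(A),n(A),f(A)$ refer to the spanning ribbon subgraph $(V(G),A)$. $G^*$ is the geometric dual of $G$ (in the same surface). The partial Petrial $G^{\tau(A)}$, $A\subseteq E(G)$, is the ribbon graph obtained from $G$ by adding a half-twist to each edge in $A$, and the Petrie dual is $G^{\times}=G^{\tau(E(G))}$. Penrose polynomial: $P(G;\lambda)=\sum_{A\subseteq E(G)}(-1)^{|A|}\lambda^{f(G^{\tau(A)})}$. Ribbon graph (Bollobás–Riordan) polynomial: $R(G;x,y,z)=\sum_{A\subseteq E(G)}(x-1)^{r(G)-r(A)}y^{n(A)}z^{c(A)-f(A)+n(A)}$. *)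

(* Defs.v *)
From HB Require Import structures.
From mathcomp Require Import all_boot all_order all_algebra.

Set Implicit Arguments.
Unset Strict Implicit.
Unset Printing Implicit Defensive.

Import Order.TTheory GRing.Theory Num.Theory.
Local Open Scope ring_scope.

(* Ribbon graphs, encoded combinatorially.  The edge disc of e is a rectangle
   [0,1] x [0,1]: its ends {0} x [0,1] and {1} x [0,1] are the two arcs glued to
   vertex discs, its sides [0,1] x {0} and [0,1] x {1} are free.
   The corner (e, i, s) is the point common to the end i and the side s. *)
Definition corner (E : finType) : finType := (E * bool * bool)%type.

Section Corners.
Variable E : finType.
Implicit Type x : corner E.

Definition edge_of x : E := x.1.1.
(* the other endpoint of the free side at x *)
Definition along x : corner E := (x.1.1, ~~ x.1.2, x.2).
(* the other endpoint of the glued end at x *)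
Definition across x : corner E := (x.1.1, x.1.2, ~~ x.2).
(* exchanges the roles of ends and sides *)
Definition turn x : corner E := (x.1.1, x.2, x.1.2).
(* regluing the end 1 of every edge of A upside down is a half-twist of A *)
Definition twist (A : {set E}) x : corner E :=
  (x.1.1, x.1.2, x.2 (+) (x.1.2 && (x.1.1 \in A))).

Lemma alongK : involutive along.
Proof. by case=> [[e i] s]; rewrite /along /= negbK. Qed.

Lemma acrossK : involutive across.
Proof. by case=> [[e i] s]; rewrite /across /= negbK. Qed.

Lemma turnK : involutive turn.
Proof. by case=> [[e i] s]. Qed.

Lemma twistK A : involutive (twist A).
Proof. by case=> [[e i] s]; rewrite /twist /= -addbA addbb addbF. Qed.

Lemma across_twist A x : across (twist A x) = twist A (across x).
Proof. by case: x => [[e i] s]; rewrite /twist /across /= addNb. Qed.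

Lemma along_turn x : along (turn x) = turn (across x).
Proof. by []. Qed.

Lemma across_turn x : across (turn x) = turn (along x).
Proof. by []. Qed.

End Corners.

Definition link (T : finType) (s t : T -> T) : rel T :=
  fun x y => (y == s x) || (y == t x).

Lemma link_csym (T : finType) (s t : T -> T) :
  involutive s -> involutive t -> connect_sym (link s t).
Proof.
move=> sK tK; apply: sym_connect_sym => x y.
by rewrite /link eq_sym (inv_eq sK) [y == t x]eq_sym (inv_eq tK).
Qed.

Lemma connect_conj (T : finType) (s t s' t' p : T -> T) :
    involutive p -> (forall x, s' (p x) = p (s x)) ->
    (forall x, t' (p x) = p (t x)) ->
  forall x y, connect (link s' t') (p x) (p y) = connect (link s t) x y.
Proof.
move=> pK Es Et x y; apply/idP/idP.
  have homo u v : connect (link s' t') u v -> connect (link s t) (p u) (p v).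
    case/connectP=> q + ->; elim: q u => [|w q IH] u /=.
      by rewrite connect0.
    case/andP=> uw /IH; apply: connect_trans; apply: connect1.
    have Eu r' r : (forall z, r' (p z) = p (r z)) ->
        (w == r' u) = (p w == r (p u)).
      by move=> Er; rewrite -{1}[u]pK Er (inv_eq pK).
    by rewrite /link -(Eu _ _ Es) -(Eu _ _ Et).
  by move/homo; rewrite !pK.
case/connectP=> q + ->; elim: q x => [|w q IH] x /=; first by rewrite connect0.
case/andP=> xw /IH; apply: connect_trans; apply: connect1.
by rewrite /link Es Et !(inj_eq (inv_inj pK)).
Qed.

(* The boundary circle of a vertex disc carries the corners lying on it; [gap]
   pairs the two endpoints of each arc of such a circle not covered by an edge
   end.  Each vertex has one boundary circle, which is the content of vtxP.
   A vertex outside the image of vtx is isolated. *)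
Record ribbon_graph := RibbonGraph {
  vertex : finType;
  edge : finType;
  vtx : corner edge -> vertex;
  gap : corner edge -> corner edge;
  gapK : involutive gap;
  gap_neq : forall x, gap x != x;
  vtxP : forall x y,
    (vtx x == vtx y) = connect (link gap (@across edge)) x y
}.

Section Faces.
Variable G : ribbon_graph.

Definition isolated (v : vertex G) := v \notin codom (@vtx G).

Definition bnd : rel (corner (edge G)) := link (@gap G) (@along (edge G)).

Lemma bnd_csym : connect_sym bnd.
Proof. exact: link_csym (@gapK G) (@alongK _). Qed.

(* A boundary component alternates gaps and free sides (and is represented by
   one of its corners), or is the boundary of an isolated vertex disc. *)
Definition face : finType :=
  ({x : corner (edge G) | fingraph.roots bnd x}
    + {v : vertex G | isolated v})%type.

Definition face_of (x : corner (edge G)) : face :=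
  inl (exist _ (fingraph.root bnd x) (roots_root bnd_csym x)).

Lemma face_ofP x y : (face_of x == face_of y) = connect bnd x y.
Proof. by rewrite -(root_connect bnd_csym). Qed.

End Faces.

Section Dual.
Variable G : ribbon_graph.

Definition dual_vtx (x : corner (edge G)) : face G := face_of (turn x).
Definition dual_gap (x : corner (edge G)) := turn (gap (turn x)).

Lemma dual_gapK : involutive dual_gap.
Proof. by move=> x; rewrite /dual_gap turnK gapK turnK. Qed.

Lemma dual_gap_neq x : dual_gap x != x.
Proof. by rewrite (inv_eq (@turnK _)) gap_neq. Qed.

Lemma dual_vtxP x y :
  (dual_vtx x == dual_vtx y) = connect (link dual_gap (@across _)) x y.
Proof.
rewrite face_ofP; apply: connect_conj => [|z|z] //; first exact: turnK.
by rewrite /dual_gap turnK.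
Qed.

(* Cap every boundary component with a disc and remove the vertex discs: the
   free sides become the glued ends. *)
Definition dual : ribbon_graph := RibbonGraph dual_gapK dual_gap_neq dual_vtxP.

End Dual.

Section Petrial.
Variables (G : ribbon_graph) (A : {set edge G}).

Definition petrial_vtx (x : corner (edge G)) := vtx (twist A x).
Definition petrial_gap (x : corner (edge G)) := twist A (gap (twist A x)).

Lemma petrial_gapK : involutive petrial_gap.
Proof. by move=> x; rewrite /petrial_gap twistK gapK twistK. Qed.

Lemma petrial_gap_neq x : petrial_gap x != x.
Proof. by rewrite (inv_eq (@twistK _ A)) gap_neq. Qed.

Lemma petrial_vtxP x y :
  (petrial_vtx x == petrial_vtx y) = connect (link petrial_gap (@across _)) x y.
Proof.
rewrite vtxP; apply: connect_conj => [|z|z]; first exact: twistK.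
  by rewrite /petrial_gap twistK.
exact: across_twist.
Qed.

Definition partial_petrial : ribbon_graph :=
  RibbonGraph petrial_gapK petrial_gap_neq petrial_vtxP.

End Petrial.

Definition petrie_dual (G : ribbon_graph) := partial_petrial [set: edge G].

Section Spanning.
Variables (G : ribbon_graph) (A : {set edge G}).

Definition sub_edge : finType := {e : edge G | e \in A}.

Definition sub_corner (x : corner sub_edge) : corner (edge G) :=
  (val x.1.1, x.1.2, x.2).

(* Once the edges outside A are deleted, a gap extends across their ends until
   it meets a corner of an edge of A, after at most #|corner (edge G)| steps. *)
Definition skip (y : corner (edge G)) :=
  if edge_of y \in A then y else gap (across y).

Definition long_gap (x : corner (edge G)) :=
  iter #|corner (edge G)| skip (gap x).

Definition gap_step (y : corner (edge G)) := gap (across y).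
Local Notation step := gap_step.

Lemma gap_step_inj : injective step.
Proof. by move=> x y /(inv_inj (@gapK G)) /(inv_inj (@acrossK _)). Qed.

Definition lands z y := exists2 k,
  y = iter k step z & edge_of y \in A /\
    forall j, (j < k)%N -> edge_of (iter j step z) \notin A.

Lemma lands_in z : edge_of z \in A -> lands z z.
Proof. by exists 0%N. Qed.

Lemma lands_step z y : edge_of z \notin A -> lands z y <-> lands (step z) y.
Proof.
move=> zA; split=> [[[|k] -> [yA lt]] | [k -> [yA lt]]].
- by rewrite yA in zA.
- exists k; first by rewrite -iterSr.
  by split=> // j jk; rewrite -iterSr; apply: lt.
- exists k.+1; first by rewrite iterSr.
  split=> // -[|j] jk //; rewrite iterSr; exact: lt.
Qed.

Lemma lands_uniq z y y' : lands z y -> lands z y' -> y = y'.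
Proof.
case=> k -> [kA lek] [k' -> [kA' lek']].
by case: (ltngtP k k') => [/lek'|/lek|-> //]; rewrite ?kA ?kA'.
Qed.

Lemma iter_skip z k : (k <= #|corner (edge G)|)%N ->
    edge_of (iter k step z) \in A ->
    (forall j, (j < k)%N -> edge_of (iter j step z) \notin A) ->
  iter #|corner (edge G)| skip z = iter k step z.
Proof.
move=> kn yA lt.
have E j : (j <= k)%N -> iter j skip z = iter j step z.
  elim: j => //= j IH jk; rewrite IH 1?ltnW // /skip.
  by rewrite (negbTE (lt j jk)).
rewrite -(subnK kn) iterD E //.
by elim: (_ - _)%N => //= m ->; rewrite /skip yA.
Qed.

Lemma long_gap_lands x : edge_of x \in A -> lands (gap x) (long_gap x).
Proof.
move=> xA.
have gS : gap x = step (across x) by rewrite /step acrossK.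
have cx : fconnect step (gap x) (across x).
  by rewrite (fconnect_sym gap_step_inj) gS fconnect1.
have k0P := iter_findex cx; have := findex_max cx.
move: (findex _ _ _) k0P => k0 k0P k0lt.
have ex : exists k, edge_of (iter k step (gap x)) \in A.
  by exists k0; rewrite k0P.
case: (ex_minnP ex) => k kA kmin.
have lt j : (j < k)%N -> edge_of (iter j step (gap x)) \notin A.
  by move=> jk; apply: contraL jk => /kmin; rewrite -leqNgt.
have kn : (k <= #|corner (edge G)|)%N.
  apply: leq_trans (leq_trans (ltnW k0lt) (max_card _)).
  by apply: kmin; rewrite k0P.
by exists k; rewrite /long_gap (iter_skip kn).
Qed.

Lemma long_gap_in x : edge_of x \in A -> edge_of (long_gap x) \in A.
Proof. by case/long_gap_lands=> k _ []. Qed.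

Lemma gap_step_rev x y k j : y = iter k step (gap x) -> (j <= k)%N ->
  iter j step (gap y) = gap (iter (k - j) step (gap x)).
Proof.
move=> Ey; elim: j => [|j IH] jk; first by rewrite subn0 Ey.
by rewrite iterS IH 1?ltnW // -(subnSK jk) /= /step gapK acrossK.
Qed.

Lemma long_gapK x : edge_of x \in A -> long_gap (long_gap x) = x.
Proof.
move=> xA; have [k Ey [yA lt]] := long_gap_lands xA.
apply: lands_uniq (long_gap_lands yA) _.
exists k; first by rewrite (gap_step_rev Ey) // subnn /= gapK.
split=> // j jk; rewrite (gap_step_rev Ey) 1?ltnW // -(subnSK jk) /= /step gapK.
by apply: lt; rewrite subnSK // leq_subr.
Qed.

Lemma long_gap_neq x : edge_of x \in A -> long_gap x != x.
Proof.
move=> xA; have [k Ey _] := long_gap_lands xA.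
apply/eqP=> Exy; rewrite Exy in Ey.
have rev := gap_step_rev Ey; have := odd_double_half k.
move: (odd k) k./2 => [] h /= Ek; subst k.
  have := rev h.+1; rewrite -addnn add1n ltnS leq_addr subSS addnK.
  move=> /(_ isT) /= /(inv_inj (@gapK G)).
  by case: (iter _ _ _) => [[e i] []].
have := rev h; rewrite -addnn add0n leq_addr addnK => /(_ isT).
by move/esym/eqP; rewrite (negbTE (gap_neq _)).
Qed.

Lemma sub_corner_inj : injective sub_corner.
Proof. by case=> [[e i] s] [[e' i'] s'] [] /val_inj -> -> ->. Qed.

Lemma sub_corner_in x : edge_of (sub_corner x) \in A.
Proof. exact: valP x.1.1. Qed.

Lemma sub_corner_across x : sub_corner (across x) = across (sub_corner x).
Proof. by []. Qed.

Lemma sub_corner_onto y : edge_of y \in A -> exists x, y = sub_corner x.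
Proof. by case: y => [[e i] s] eA; exists (exist _ e eA, i, s). Qed.

Definition sub_vtx (x : corner sub_edge) := vtx (sub_corner x).

Definition sub_gap (x : corner sub_edge) : corner sub_edge :=
  let y := long_gap (sub_corner x) in
  (exist _ (edge_of y) (long_gap_in (sub_corner_in x)), y.1.2, y.2).

Lemma sub_gapE x : sub_corner (sub_gap x) = long_gap (sub_corner x).
Proof. by rewrite /sub_corner /sub_gap /=; case: (long_gap _) => [[]]. Qed.

Lemma sub_gapK : involutive sub_gap.
Proof.
move=> x; apply: sub_corner_inj.
by rewrite !sub_gapE long_gapK // sub_corner_in.
Qed.

Lemma sub_gap_neq x : sub_gap x != x.
Proof.
by rewrite -(inj_eq sub_corner_inj) sub_gapE long_gap_neq // sub_corner_in.
Qed.

Lemma vtx_gap (x : corner (edge G)) : vtx (gap x) = vtx x.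
Proof.
by apply/eqP; rewrite eq_sym vtxP connect1 // /link eqxx.
Qed.

Lemma vtx_across (x : corner (edge G)) : vtx (across x) = vtx x.
Proof.
by apply/eqP; rewrite eq_sym vtxP connect1 // /link eqxx orbT.
Qed.

Lemma vtx_long_gap x : vtx (long_gap x) = vtx x.
Proof.
rewrite -[RHS]vtx_gap /long_gap; elim: #|_| => //= m <-.
by rewrite /skip; case: ifP => // _; rewrite vtx_gap vtx_across.
Qed.

Lemma sub_vtxP x y :
  (sub_vtx x == sub_vtx y) = connect (link sub_gap (@across _)) x y.
Proof.
apply/idP/idP; last first.
  case/connectP=> q + ->; elim: q x => [|w q IH] x /=; first by rewrite eqxx.
  case/andP=> xw /IH; suff -> : sub_vtx x = sub_vtx w by [].
  case/orP: xw => /eqP ->; rewrite /sub_vtx ?sub_gapE ?vtx_long_gap //.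
  by rewrite sub_corner_across vtx_across.
rewrite vtxP => /connectP[q]; set rel' := link sub_gap _.
pose good z := exists2 w, lands z (sub_corner w) & connect rel' x w.
have good_in w : good (sub_corner w) <-> connect rel' x w.
  split=> [[w' lw'] | xw]; last first.
    by exists w => //; apply/lands_in/sub_corner_in.
  by have /sub_corner_inj-> := lands_uniq (lands_in (sub_corner_in w)) lw'.
have good_out z : edge_of z \notin A -> good z <-> good (gap (across z)).
  by move=> zA; split=> -[w lw xw]; exists w => //; apply/(lands_step _ zA).
have good_gap z : edge_of z \in A -> good z -> good (gap z).
  case/sub_corner_onto=> w -> /good_in xw; exists (sub_gap w).
    by rewrite sub_gapE; apply/long_gap_lands/sub_corner_in.
  by apply: connect_trans xw (connect1 _); rewrite /rel' /link eqxx.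
have good_across z : edge_of z \in A -> good z -> good (across z).
  case/sub_corner_onto=> w -> /good_in xw; rewrite -sub_corner_across.
  apply/good_in/(connect_trans xw)/connect1.
  by rewrite /rel' /link eqxx orbT.
pose good2 z := good z /\ good (across z).
have step2 z w : link (@gap G) (@across _) z w -> good2 z -> good2 w.
  case/orP=> /eqP -> [gz gaz]; last by split; rewrite ?acrossK.
  have ggz : good (gap z).
    case: (boolP (edge_of z \in A)) => zA; first exact: good_gap.
    by have := good_out (across z) zA; rewrite acrossK => -[+ _]; apply.
  split=> //; case: (boolP (edge_of (gap z) \in A)) => zA.
    exact: good_across.
  by apply/(good_out (across (gap z)) zA); rewrite acrossK gapK.
have: good2 (sub_corner x).
  have gx : good (sub_corner x) by apply/good_in.
  by split=> //; apply: good_across => //; apply: sub_corner_in.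
elim: q (sub_corner x) => [|w q IH] z /= gz.
  by move=> _ Ey; case: gz; rewrite -Ey => /good_in.
by case/andP=> zw; apply: IH; apply: step2 zw gz.
Qed.

Definition spanning_subgraph : ribbon_graph :=
  RibbonGraph sub_gapK sub_gap_neq sub_vtxP.

End Spanning.

Section Counts.
Variable G : ribbon_graph.

Definition adjacent : rel (vertex G) := fun v w =>
  [exists x : corner (edge G), (vtx x == v) && (vtx (along x) == w)].

Definition comps : nat := n_comp adjacent predT.
Definition faces : nat := #|face G|.
(* int avoids the truncated subtraction of nat *)
Definition rank : int := #|vertex G|%:Z - comps%:Z.
Definition nullity : int := #|edge G|%:Z - rank.

End Counts.

Definition penrose (G : ribbon_graph) : {poly int} :=
  \sum_(A : {set edge G})
    (-1) ^+ #|A| * 'X ^+ faces (partial_petrial A).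

(* value of the ribbon graph polynomial at a point of a field *)
Definition ribbon_poly (F : fieldType) (G : ribbon_graph) (x y z : F) : F :=
  \sum_(A : {set edge G})
    let H := spanning_subgraph A in
    (x - 1) ^ (rank G - rank H) * y ^ nullity H
      * z ^ ((comps H)%:Z - (faces H)%:Z + nullity H).

(* Main.v *)
(** Termwise in the edge set [A]: tracing a boundary component of the partial
    Petrial of the dual along an edge [e], one crosses a vertex arc of [G] when
    [e] is not in [A], and passes to the diagonally opposite corner when [e] is
    in [A].  Boundary components of the spanning subgraph [A] of the Petrie dual
    follow the same rule, since deleting [e] means crossing its ends, and the
    free sides of a twisted edge join diagonally opposite corners.  So the two
    ribbon graphs have equally many faces, and at the given point the rank and
    nullity exponents of [R] cancel down to the number of faces. *)
Require Import Defs.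
From mathcomp Require Import all_boot all_order all_algebra.
From mathcomp Require Import ring.
Import GRing.Theory.
Local Open Scope ring_scope.

Set Implicit Arguments.
Unset Strict Implicit.
Unset Printing Implicit Defensive.

(** * Orbit counts of pairs of involutions *)

(** The conjugating involution [p] is an adjunction between the two relations, hence a bijection on
    components. *)
Lemma n_comp_conj (T : finType) (s t s' t' p : T -> T) :
    involutive s -> involutive t -> involutive s' -> involutive t' ->
    involutive p -> (forall x, s' (p x) = p (s x)) ->
    (forall x, t' (p x) = p (t x)) ->
  n_comp (link s' t') predT = n_comp (link s t) predT.
Proof.
move=> sK tK sK' tK' pK Es Et.
rewrite (@adjunction_n_comp _ _ p (link s' t') (link s t)) //;
  try exact: link_csym.
split=> [x _|x y _]; first by exists (p x); rewrite pK connect0.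
by rewrite (connect_conj pK Es Et).
Qed.

Lemma faces_n_comp (G : ribbon_graph) :
  faces G = (n_comp (@bnd G) predT + #|[pred v : vertex G | isolated v]|)%N.
Proof.
rewrite /faces card_sum !card_sig; congr addn.
by apply: eq_card => x; rewrite !inE andbT.
Qed.

(** * Faces of a spanning subgraph, traced on the corners of [G] *)

Section SpanningFaces.
Variables (G : ribbon_graph) (A : {set edge G}).

(** Boundary tracing of the subgraph [A] without removing corners: on a deleted edge the boundary
    runs across its glued end. *)
Definition mate (x : corner (edge G)) :=
  if edge_of x \in A then along x else across x.

Lemma mateK : involutive mate.
Proof.
move=> x; rewrite /mate; case: (boolP (edge_of x \in A)) => xA.
  by rewrite [edge_of _]/= xA alongK.
by rewrite [edge_of _]/= (negbTE xA) acrossK.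
Qed.

Local Notation rel_mate := (link (@gap G) mate).
Local Notation subc := (@sub_corner G A).

Lemma rel_mate_csym : connect_sym rel_mate.
Proof. exact: link_csym (@gapK G) mateK. Qed.

Lemma connect_long_gap x : connect rel_mate x (long_gap A x).
Proof.
rewrite /long_gap; elim: #|_| => [|m IH] /=.
  by rewrite connect1 // /link eqxx.
apply: connect_trans IH _; rewrite /skip; case: ifP => yA; first exact: connect0.
set y := iter _ _ _ in yA *.
apply: (@connect_trans _ _ (mate y)).
  by rewrite connect1 // /link eqxx orbT.
by rewrite /mate yA connect1 // /link eqxx.
Qed.

Lemma connect_sub_corner x y :
  connect (@bnd (spanning_subgraph A)) x y = connect rel_mate (subc x) (subc y).
Proof.
apply/idP/idP.
  case/connectP=> q + ->; elim: q x => [|w q IH] x /=; first by rewrite connect0.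
  case/andP=> xw /IH; apply: connect_trans; case/orP: xw => /eqP ->.
    by rewrite sub_gapE connect_long_gap.
  by rewrite connect1 // /link /mate sub_corner_in eqxx orbT.
case/connectP=> q; set rel' := @bnd _.
(* Invariant for the converse: the first kept corner met from [z] by crossing deleted edges is
   reachable from [x] in the subgraph. *)
pose good z := exists2 w, lands A z (subc w) & connect rel' x w.
have good_in w : good (subc w) <-> connect rel' x w.
  split=> [[w' lw'] | xw]; last first.
    by exists w => //; apply/lands_in/sub_corner_in.
  by have /sub_corner_inj-> := lands_uniq (lands_in (sub_corner_in w)) lw'.
have good_out z : edge_of z \notin A -> good z <-> good (gap (across z)).
  by move=> zA; split=> -[w lw xw]; exists w => //; apply/(lands_step _ zA).
have good_gap z : edge_of z \in A -> good z -> good (gap z).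
  case/sub_corner_onto=> w -> /good_in xw; exists (@gap (spanning_subgraph A) w).
    by rewrite sub_gapE; apply/long_gap_lands/sub_corner_in.
  by apply: connect_trans xw (connect1 _); rewrite /rel' /bnd /link eqxx.
have good_along z : edge_of z \in A -> good z -> good (along z).
  case/sub_corner_onto=> w -> /good_in xw; apply/(good_in (along w)).
  apply: connect_trans xw (connect1 _).
  by rewrite /rel' /bnd /link eqxx orbT.
(* Tracing a deleted edge from [z] continues on the other side of the gap at
   [z], so the invariant has to control both ends of that gap. *)
pose good2 z := good z /\ good (gap z).
have step2 z w : rel_mate z w -> good2 z -> good2 w.
  case/orP=> /eqP -> [gz ggz]; first by split; rewrite ?gapK.
  rewrite /mate; case: (boolP (edge_of z \in A)) => zA.
    by have ga := good_along _ zA gz; split=> //; apply: good_gap ga.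
  split; last by apply/(good_out z zA).
  by apply/(good_out (across z) zA); rewrite acrossK.
have: good2 (subc x).
  have gx : good (subc x) by apply/good_in.
  by split=> //; apply: good_gap => //; apply: sub_corner_in.
elim: q (subc x) => [|w q IH] z /= gz.
  by move=> _ Ey; case: gz; rewrite -Ey => /good_in.
by case/andP=> zw; apply: IH; apply: step2 zw gz.
Qed.

Definition kept : {pred corner (edge G)} := [pred x | edge_of x \in A].
(** These orbits carry the faces of the subgraph that have corners; the remaining orbits bound
    vertices whose edges are all deleted. *)
Definition touched := closure rel_mate kept.

Lemma touchedP x :
  reflect (exists2 y, edge_of y \in A & connect rel_mate x y) (x \in touched).
Proof.
apply: (iffP pred0Pn) => [[y /andP[xy yA]] | [y yA xy]]; exists y => //.
by apply/andP.
Qed.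

Lemma n_comp_touched :
  n_comp (@bnd (spanning_subgraph A)) predT = n_comp rel_mate touched.
Proof.
have adj : rel_adjunction subc rel_mate (@bnd (spanning_subgraph A)) touched.
  split=> [x xA|x y _]; last exact: connect_sub_corner.
  apply: sigW; have /touchedP[y /sub_corner_onto[w ->] xw] := xA.
  by exists w.
rewrite (adjunction_n_comp subc rel_mate_csym (@bnd_csym (spanning_subgraph A))
  (closure_closed rel_mate_csym _) adj).
apply: eq_n_comp_r => x; rewrite !inE; apply/esym/touchedP.
by exists (subc x); rewrite ?connect0 ?sub_corner_in.
Qed.

(** Without kept corners [mate] is [across] along the whole orbit, which is therefore a full vertex
    circle. *)
Lemma untouched_path x y : x \notin touched ->
  connect (link (@gap G) (@across _)) x y = connect rel_mate x y.
Proof.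
move=> xA; have nA z : connect rel_mate x z -> edge_of z \notin A.
  by move=> xz; apply: contra xA => zA; apply/touchedP; exists z.
have mateE z : connect rel_mate x z -> mate z = across z.
  by move=> /nA zA; rewrite /mate (negbTE zA).
apply/idP/idP => /connectP[q + ->].
  elim/last_ind: q => [|q z IH]; first by rewrite connect0.
  rewrite rcons_path last_rcons => /andP[/IH xl lz].
  by apply: connect_trans (xl) (connect1 _); rewrite /link (mateE _ xl).
elim/last_ind: q => [|q z IH]; first by rewrite connect0.
rewrite rcons_path last_rcons => /andP[xq lz].
apply: connect_trans (IH xq) _; apply: connect1.
by rewrite /link -mateE //; apply/connectP; exists q.
Qed.

Lemma touched_vtx x y : x \notin touched -> vtx y = vtx x -> edge_of y \notin A.
Proof.
move=> xA /eqP; rewrite eq_sym vtxP untouched_path // => xy.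
by apply: contra xA => yA; apply/touchedP; exists y.
Qed.

Lemma notin_touched x :
  (forall y, vtx y = vtx x -> edge_of y \notin A) -> x \notin touched.
Proof.
move=> xA; apply/touchedP=> -[y + /connectP[q]].
elim: q x xA => [|z q IH] x xA /= yA.
  by move=> _ Ey; move: (xA x erefl); rewrite -Ey yA.
case/andP=> xz qP Ey; apply: (IH z _ yA qP Ey) => w.
suff -> : vtx z = vtx x by apply: xA.
case/orP: xz => /eqP ->; first exact: vtx_gap.
by rewrite /mate (negbTE (xA x erefl)) vtx_across.
Qed.

Lemma isolated_spanningP (v : vertex G) :
  reflect (forall y, vtx y = v -> edge_of y \notin A)
          (@isolated (spanning_subgraph A) v).
Proof.
apply: (iffP idP) => [/codomP vA y yv | vA].
  by apply/negP=> /sub_corner_onto[w yw]; case: vA; exists w; rewrite -yv yw.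
apply/codomP=> -[w vw]; have := vA (subc w) (esym vw).
by rewrite sub_corner_in.
Qed.

Lemma isolated_spanning :
  #|[pred v : vertex (spanning_subgraph A) | isolated v]| =
  (n_comp rel_mate [predC touched] + #|[pred v : vertex G | isolated v]|)%N.
Proof.
rewrite -(cardID [pred v : vertex G | isolated v]) addnC; congr addn; last first.
  apply: eq_card => v; rewrite !inE andbC /=; apply: andb_idr => /codomP iv.
  by apply/isolated_spanningP=> y yv; case: iv; exists y.
(* The newly isolated vertices are counted by the roots of the untouched orbits, on which [vtx] is
   injective. *)
transitivity #|image (@vtx G) (predI (fingraph.roots rel_mate) [predC touched])|;
    last first.
  apply: card_in_image => x y.
  rewrite !inE => /andP[/eqP xr xA] /andP[/eqP yr yA] /eqP.
  by rewrite vtxP untouched_path // => /(fingraph.rootP rel_mate_csym); rewrite xr yr.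
apply: eq_card => v; rewrite !inE.
apply/andP/imageP => [[/negPn/codomP[x vx] iv]|[x]]; last first.
  rewrite !inE => /andP[_ xA] ->; split; first by rewrite negbK codom_f.
  by apply/isolated_spanningP=> y; exact: touched_vtx.
have xA : x \notin touched.
  by apply: notin_touched => y; rewrite -vx; exact: (isolated_spanningP v iv).
have xr := connect_root rel_mate x.
exists (fingraph.root rel_mate x).
  rewrite !inE roots_root; last exact: rel_mate_csym.
  by rewrite -(closed_connect (closure_closed rel_mate_csym _) xr).
by apply/eqP; rewrite vx vtxP untouched_path.
Qed.

(** Touched orbits give the faces with corners and untouched ones the newly isolated discs, so
    together all orbits are counted. *)
Lemma faces_spanning : faces (spanning_subgraph A) =
  (n_comp rel_mate predT + #|[pred v : vertex G | isolated v]|)%N.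
Proof.
rewrite faces_n_comp isolated_spanning n_comp_touched addnA.
by rewrite -n_compC //; exact/closure_closed/rel_mate_csym.
Qed.

End SpanningFaces.

(** * Isolated vertices under Petrials and duality *)

Lemma twist_isolated (G : ribbon_graph) (A : {set edge G}) (v : vertex G) :
  @isolated (partial_petrial A) v = isolated v.
Proof.
congr (~~ _); apply/codomP/codomP => -[x ->]; first by exists (twist A x).
by exists (twist A x); rewrite /= /petrial_vtx twistK.
Qed.

(** A boundary component with corners is the dual vertex of its turned root corner; the boundary of
    an isolated disc carries no corner. *)
Lemma dual_isolated (G : ribbon_graph) (f : face G) :
  @isolated (dual G) f = if f is inr _ then true else false.
Proof.
case: f => [[r rr] | v]; last by apply/codomP=> -[].
apply/negbTE; rewrite negbK; apply/codomP; exists (turn r).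
rewrite /= /dual_vtx turnK /face_of; congr inl; apply: val_inj => /=.
exact/esym/eqP.
Qed.

Lemma card_dual_isolated (G : ribbon_graph) :
  #|[pred f : vertex (dual G) | isolated f]| =
  #|[pred v : vertex G | isolated v]|.
Proof.
pose r := @inr {x | fingraph.roots (@bnd G) x} {v : vertex G | isolated v}.
transitivity #|image r predT|; last first.
  by rewrite card_image => [|v w []//]; exact: card_sig.
apply: eq_card => f; rewrite inE dual_isolated.
apply/idP/imageP; first by case: f => // v _; exists v.
by case=> v _ ->.
Qed.

(** * Comparison of the two face counts *)

Section Diagonal.
Variables (G : ribbon_graph) (A : {set edge G}).

(** The tracing rule on [G] to which both face counts are conjugated. *)
Definition diag (x : corner (edge G)) :=
  if edge_of x \in A then along (across x) else across x.

Lemma diagK : involutive diag.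
Proof.
case=> [[e i] s]; rewrite /diag /along /across /edge_of /=.
by case eA: (e \in A); rewrite /= eA /= ?negbK.
Qed.

(** A full twist set commutes with [across], but [along] changes the end and so picks up a flip of
    the side. *)
Lemma mate_twist (x : corner (edge G)) :
  @mate (petrie_dual G) A (twist setT x) = twist setT (diag x).
Proof.
case: x => [[e i] s]; rewrite /mate /diag /along /across /edge_of /twist /=.
by case: (e \in A); rewrite /= !inE !andbT; case: i; case: s.
Qed.

Lemma n_comp_petrie_mate :
  n_comp (link (@gap (petrie_dual G)) (@mate (petrie_dual G) A)) predT =
  n_comp (link (@gap G) diag) predT.
Proof.
apply: (n_comp_conj (p := twist setT)).
- exact: (@gapK G).
- exact: diagK.
- exact: (@gapK (petrie_dual G)).
- exact: mateK.
- exact: twistK.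
- by move=> x; rewrite /= /petrial_gap twistK.
exact: mate_twist.
Qed.

Lemma n_comp_petrial_dual :
  n_comp (@bnd (@partial_petrial (dual G) A)) predT =
  n_comp (link (@gap G) diag) predT.
Proof.
(* The free sides with the twist undone: diagonal on [A], [along] elsewhere. Then [turn] fixes the
   diagonal move and exchanges [along] with [across], giving [diag]. *)
pose along' x := twist A (along (twist A x)).
have along'K : involutive along' by move=> x; rewrite /along' twistK alongK twistK.
transitivity (n_comp (link (@gap (dual G)) along') predT).
  apply: (n_comp_conj (p := twist A)).
  - exact: (@gapK (dual G)).
  - exact: along'K.
  - exact: (@gapK (@partial_petrial (dual G) A)).
  - exact: alongK.
  - exact: twistK.
  - by move=> x; rewrite /= /petrial_gap twistK.
  by move=> x; rewrite /along' twistK.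
apply: (n_comp_conj (p := @turn (edge G))).
- exact: (@gapK G).
- exact: diagK.
- exact: (@gapK (dual G)).
- exact: along'K.
- exact: turnK.
- by move=> x; rewrite /= /dual_gap turnK.
case=> [[e i] s].
rewrite /along' /diag /along /across /edge_of /twist /turn /=.
by case: (e \in A); rewrite /= ?andbT ?andbF; case: i; case: s.
Qed.

Lemma faces_petrial_dual :
  faces (@partial_petrial (dual G) A) =
  faces (@spanning_subgraph (petrie_dual G) A).
Proof.
rewrite faces_n_comp faces_spanning n_comp_petrial_dual n_comp_petrie_mate.
congr addn; transitivity #|[pred v : vertex G | isolated v]|.
  rewrite -(card_dual_isolated G); apply: (@eq_card (face G)) => f.
  by rewrite !inE (@twist_isolated (dual G)).
by apply: (@eq_card (vertex G)) => v; rewrite !inE (@twist_isolated G).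
Qed.

End Diagonal.

(** * Cancellation of exponents and the identity *)

Lemma ribbon_term_collapse (F : fieldType) (l : F) (cG cA fA v a : nat) :
    l != 0 ->
  let rG := v%:Z - cG%:Z in
  let rA := v%:Z - cA%:Z in
  let nA := a%:Z - rA in
  l ^+ cG * (-1) ^ rG *
    ((1 - l - 1) ^ (rG - rA) * (- l) ^ nA * (1 / l) ^ (cA%:Z - fA%:Z + nA)) =
  (-1) ^+ a * l ^+ fA.
Proof.
move=> l0 rG rA nA.
have m0 : (-1 : F) != 0 by rewrite oppr_eq0 oner_neq0.
have -> : 1 - l - 1 = -1 * l by rewrite mulN1r addrAC subrr add0r.
rewrite div1r exprz_inv -[- l]mulN1r !expfzMl.
transitivity (((-1) ^ rG * (-1) ^ (rG - rA) * (-1) ^ nA) *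
  (l ^ cG%:Z * l ^ (rG - rA) * l ^ nA * l ^ (- (cA%:Z - fA%:Z + nA)))).
  by rewrite -exprnP !mulrA; ring.
rewrite -!expfzDr //; congr (_ * _).
  (* Since [rA + nA = a], the exponent of -1 has the parity of [a]. *)
  have -> : rG + (rG - rA) + nA = 2 * (rG - rA) + a%:Z by rewrite /nA; ring.
  by rewrite expfzDr // -exprz_exp -[2]/(2%N%:Z) -!exprnP sqrrN expr1n exp1rz mul1r.
(* The exponent of [l] reduces to [fA] because [cG + rG = v = cA + rA]. *)
by rewrite exprnP; congr (_ ^ _); rewrite /nA /rG /rA; ring.
Qed.

Theorem theorem4p6 (G : ribbon_graph) :
  let lambda : {fraction {poly int}} := FracField.tofrac ('X : {poly int}) in
  FracField.tofrac (penrose (dual G)) =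
    lambda ^+ comps (petrie_dual G) * (-1) ^ rank (petrie_dual G)
      * ribbon_poly (petrie_dual G) (1 - lambda) (- lambda) (1 / lambda).
Proof.
move=> lambda.
have l0 : lambda != 0 by rewrite tofrac_eq0 polyX_eq0.
(* [dual G] and [petrie_dual G] share the edge type of [G], so the sums are compared term by
   term. *)
rewrite /penrose /ribbon_poly rmorph_sum mulr_sumr; apply: eq_bigr => A _.
rewrite rmorphM !rmorphXn rmorphN1 -/lambda faces_petrial_dual /=.
(* The subgraph has [#|A|] edges and keeps all vertices, so both ranks involve the same [v]. *)
rewrite /nullity /rank card_sig ribbon_term_collapse //.
Qed.
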